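(* Let $(\mathfrak g,J,g)$ be an almost abelian pseudo-Kähler Lie algebra of dimension eight and signature $(6,2)$, with codimension-one abelian ideal $\mathfrak h$, such that $\mathfrak h_0=\mathfrak h^\perp\oplus J\mathfrak h^\perp$ is isotropic. Then $(\mathfrak g,J,g)$ is isomorphic, by a unitary Lie algebra isomorphism, to $\mathfrak g_D$ for some $D$ in one of the following cases: (a) $D$ is one of $D_1(c_2),D_4(c_1),D_5,D_6$, where $c_1,c_2\in\mathbb R$ and, for some $\lambda_1,\lambda_2\in\mathbb R$, the map $D$ sends $e_3\mapsto-\lambda_1e_4$, $e_4\mapsto\lambda_1e_3$, $e_5\mapsto-\lambda_2e_6$, $e_6\mapsto\lambda_2e_5$ and - $D_1(c_2)$: $e_1\mapsto-e_1$, $e_2\mapsto-e_2$, $e_7\mapsto c_2e_2+e_7$; - $D_4(c_1)$: $e_1,e_2\mapsto0$, $e_7\mapsto c_1e_1+e_2$; - $D_5$: $e_1,e_2\mapsto0$, $e_7\mapsto e_1$; - $D_6$: $e_1,e_2,e_7\mapsto0$; (b) $D=\begin{pmatrix}0&0&0&-1&0&0&0\\0&0&1&0&0&0&0\\0&0&0&0&0&0&1\\0&0&0&0&0&0&0\\0&0&0&0&0&\lambda&0\\0&0&0&0&-\lambda&0&0\\0&0&0&0&0&0&0\end{pmatrix}$ with $\lambda\ge0$; (c) $D=\begin{pmatrix}0&0&0&-x&0&0&0\\0&0&x&0&0&0&1\\0&0&0&0&0&0&x\\0&0&0&0&0&0&0\\0&0&0&0&0&\lambda&0\\0&0&0&0&-\lambda&0&0\\0&0&0&0&0&0&0\end{pmatrix}$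 with $x\ge0$, $\lambda\in\mathbb R$.
   Context: Lie algebras are real. A Lie algebra is almost abelian if it has a codimension-one abelian ideal $\mathfrak h$. A pseudo-Kähler structure on $\mathfrak g$ is a pair $(J,g)$ with $J\in\mathrm{End}(\mathfrak g)$, $J^2=-\mathrm{Id}$, $[X,Y]+J[JX,Y]+J[X,JY]-[JX,JY]=0$; $g$ a nondegenerate symmetric bilinear form with $g(JX,JY)=g(X,Y)$; and $\omega=g(J\cdot,\cdot)$ satisfying $\omega([X,Y],Z)+\omega([Y,Z],X)+\omega([Z,X],Y)=0$. $\mathfrak h_0$ is isotropic if $g|_{\mathfrak h_0}=0$. Signature $(6,2)$ means six positive and two negative directions. A unitary isomorphism is one intertwining the complex structures and preserving the metrics. For $D\in\mathrm{End}(\mathrm{Span}\{e_1,\dots,e_7\})$ (matrices are in the basis $e_1,\dots,e_7$), $\mathfrak g_D$ denotes the Lie algebra with basis $e_1,\dots,e_8$ in which $\mathrm{Span}\{e_1,\dots,e_7\}$ is an abelian ideal and $[e_8,X]=DX$ for $X$ in it, endowed with $Je_1=e_2$, $Je_3=e_4$, $Je_5=e_6$, $Je_7=e_8$ and $g=e^1\odot e^8-e^2\odot e^7+\sum_{i=3}^6e^i\otimes e^i$, where $e^i\odot e^j=e^i\otimes e^j+e^j\otimes e^i$. *)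

(* Defs.v *)
From HB Require Import structures.
From mathcomp Require Import all_boot all_order all_algebra reals ring.

Set Implicit Arguments.
Unset Strict Implicit.
Unset Printing Implicit Defensive.

Import Order.TTheory GRing.Theory Num.Theory.
Local Open Scope ring_scope.

Record lieBracket (R : fieldType) (V : vectType R) := LieBracket {
  lie_br :> {bilinear V -> V -> V};
  lie_alt : forall x, lie_br x x = 0;
  lie_jacobi : forall x y z,
    lie_br x (lie_br y z) + lie_br y (lie_br z x) + lie_br z (lie_br x y) = 0
}.

Section LieTheory.
Variables (R : realType) (V : vectType R).
Implicit Types (b : lieBracket V) (J : 'End(V)) (g : {symmetric V}).
Implicit Types (h : {vspace V}).

Definition abelian_ideal b h : Prop :=
  (forall x y, y \in h -> b x y \in h) /\ {in h &, forall x y, b x y = 0}.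

Definition codim1_abelian_ideal b h : Prop :=
  (\dim h).+1 = \dim {:V} /\ abelian_ideal b h.

Record pseudo_Kahler b J g : Prop := PseudoKahler {
  pK_complex : forall x, J (J x) = - x;
  pK_integrable : forall x y,
    b x y + J (b (J x) y) + J (b x (J y)) - b (J x) (J y) = 0;
  pK_nondegenerate : nondegenerate g;
  pK_compatible : forall x y, g (J x) (J y) = g x y;
  pK_closed : forall x y z,
    let omega u v := g (J u) v in
    omega (b x y) z + omega (b y z) x + omega (b z x) y = 0
}.

(* In particular p + q is the dimension of V, and g is nondegenerate. *)
Definition has_signature g (p q : nat) : Prop :=
  exists e : (p + q).-tuple V,
    [/\ basis_of fullv e,
        forall i j, i != j -> g (tnth e i) (tnth e j) = 0,
        forall i : 'I_(p + q), (i < p)%N -> 0 < g (tnth e i) (tnth e i)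
      & forall i : 'I_(p + q), (p <= i)%N -> g (tnth e i) (tnth e i) < 0].

Definition isotropic g h : Prop := {in h &, forall x y, g x y = 0}.

End LieTheory.

Definition unitary_Lie_isomorphic (R : realType) (V W : vectType R)
    (bV : lieBracket V) (JV : 'End(V)) (gV : {symmetric V})
    (bW : lieBracket W) (JW : 'End(W)) (gW : {symmetric W}) : Prop :=
  exists f : 'Hom(V, W),
    [/\ bijective f,
        forall x y, f (bV x y) = bW (f x) (f y),
        forall x, f (JV x) = JW (f x)
      & isometry gW gV f].

(* One-based indices: [ix i : 'I_n.+1] is the position of the basis vector
   e_i, for 1 <= i <= n.+1 (only such i are used; [inZp] wraps around). *)
Definition ix {n : nat} (i : nat) : 'I_n.+1 := inZp i.-1.

Section Model.
Variable R : realType.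

(* The underlying space of g_D is 'rV[R]_8 with e_i = delta_mx 0 (ix i).
   The matrix D : 'M[R]_7 acts on column vectors, so its j-th column is the
   image of e_j; on row vectors it acts by right multiplication by D^T.
   [model_ad D] is the matrix of ad e_8 : it is D on e_1, .., e_7 and it kills
   e_8. *)
Definition model_ad (D : 'M[R]_7) : 'M[R]_8 :=
  block_mx D 0 0 (0 : 'M[R]_1).

Definition model_bracket_fun (D : 'M[R]_7) (x y : 'rV[R]_8) : 'rV[R]_8 :=
  x 0 (ix 8) *: (y *m (model_ad D)^T) - y 0 (ix 8) *: (x *m (model_ad D)^T).

Lemma model_bracket_bilinear D : bilinear_for
  (GRing.Scale.Law.clone _ _ *:%R _) (GRing.Scale.Law.clone _ _ *:%R _)
  (model_bracket_fun D).
Proof.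
split=> [y|x] a u v /=; rewrite /model_bracket_fun !mxE !mulmxDl -!scalemxAl;
  by apply/rowP => j; rewrite !mxE; ring.
Qed.

HB.instance Definition _ D := bilinear_isBilinear.Build R
  'rV[R]_8 'rV[R]_8 'rV[R]_8 _ _ (model_bracket_fun D)
  (model_bracket_bilinear D).

Lemma model_bracket_alt D x : model_bracket_fun D x x = 0.
Proof. by rewrite /model_bracket_fun subrr. Qed.

Lemma model_bracket_e8 D x y : model_bracket_fun D x y 0 (ix 8) = 0.
Proof.
have ad8 (z : 'rV[R]_8) : (z *m (model_ad D)^T) 0 (ix 8) = 0.
  have -> : ix 8 = rshift 7 (0 : 'I_1) :> 'I_(7 + 1).
    exact: val_inj.
  rewrite mxE big1 // => k _.
  have ad0 : (block_mx D 0 0 0 : 'M[R]_(7 + 1)) (rshift 7 0) k = 0.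
    by rewrite col_mxEd row_mx0 mxE.
  by rewrite mxE [X in _ * X]ad0 mulr0.
have subE (a c : R) (u v : 'rV[R]_8) i :
  (a *: u - c *: v) 0 i = a * u 0 i - c * v 0 i by rewrite !mxE.
by rewrite /model_bracket_fun subE !ad8 !mulr0 subrr.
Qed.

Lemma model_bracket_jacobi D x y z :
  model_bracket_fun D x (model_bracket_fun D y z) +
  model_bracket_fun D y (model_bracket_fun D z x) +
  model_bracket_fun D z (model_bracket_fun D x y) = 0.
Proof.
have brE u v w : model_bracket_fun D u (model_bracket_fun D v w) =
    u 0 (ix 8) *: (model_bracket_fun D v w *m (model_ad D)^T).
  by rewrite {1}/model_bracket_fun model_bracket_e8 scale0r subr0.
rewrite !brE /model_bracket_fun !mulmxBl -!scalemxAl.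
by apply/rowP => j; rewrite !mxE; ring.
Qed.

Definition model_bracket (D : 'M[R]_7) : lieBracket 'rV[R]_8 :=
  @LieBracket R 'rV[R]_8 (model_bracket_fun D)
    (model_bracket_alt D) (model_bracket_jacobi D).

(* Row i of the matrix is the image of e_i. *)
Definition model_J : 'End('rV[R]_8) :=
  linfun (mulmxr (\sum_(i <- [:: 1; 3; 5; 7]%N)
    (delta_mx (ix i) (ix i.+1) - delta_mx (ix i.+1) (ix i)))).

Definition model_metric (x y : 'rV[R]_8) : R :=
  let odot (i j : nat) := x 0 (ix i) * y 0 (ix j) + x 0 (ix j) * y 0 (ix i) in
  odot 1%N 8%N - odot 2%N 7%N + \sum_(3 <= i < 7) x 0 (ix i) * y 0 (ix i).

Lemma model_metricE x y : model_metric x y =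
  x 0 (ix 1) * y 0 (ix 8) + x 0 (ix 8) * y 0 (ix 1)
  - (x 0 (ix 2) * y 0 (ix 7) + x 0 (ix 7) * y 0 (ix 2))
  + (x 0 (ix 3) * y 0 (ix 3) + x 0 (ix 4) * y 0 (ix 4)
     + x 0 (ix 5) * y 0 (ix 5) + x 0 (ix 6) * y 0 (ix 6)).
Proof. by rewrite /model_metric unlock /= addr0 !addrA. Qed.

Lemma model_metricDl y : zmod_morphism (model_metric ^~ y).
Proof.
by move=> u v; rewrite !model_metricE !mxE; ring.
Qed.

Lemma model_metricZl y : scalable_for *%R (model_metric ^~ y).
Proof.
by move=> a u; rewrite !model_metricE !mxE; ring.
Qed.

Lemma model_metricC x y : model_metric x y = model_metric y x.
Proof. by rewrite !model_metricE; ring. Qed.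

Lemma model_metricDr x : zmod_morphism (model_metric x).
Proof. by move=> u v; rewrite !(model_metricC x) model_metricDl. Qed.

Lemma model_metricZr x : scalable_for (idfun \; *%R) (model_metric x).
Proof. by move=> a u; rewrite !(model_metricC x) model_metricZl. Qed.

HB.instance Definition _ := isBilinear.Build R 'rV[R]_8 'rV[R]_8 R
  *%R (idfun \; *%R) model_metric
  model_metricDl model_metricDr model_metricZl model_metricZr.

Lemma model_metric_sym x y :
  model_metric x y = (-1) ^+ false * idfun (model_metric y x).
Proof. by rewrite expr0 mul1r model_metricC. Qed.

HB.instance Definition _ := isHermitianSesquilinear.Build R 'rV[R]_8
  false idfun model_metric model_metric_sym.

Definition model_g : {symmetric 'rV[R]_8} := model_metric.

(* [E_ i j] sends e_j to e_i and the other basis vectors to 0. *)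
Local Notation E_ i j := (delta_mx (ix i) (ix j) : 'M[R]_7).

(* e_3 |-> - l1 e_4, e_4 |-> l1 e_3, e_5 |-> - l2 e_6, e_6 |-> l2 e_5. *)
Definition Drot (l1 l2 : R) : 'M[R]_7 :=
  l1 *: (E_ 3 4 - E_ 4 3) + l2 *: (E_ 5 6 - E_ 6 5).

Definition D1 (l1 l2 c2 : R) : 'M[R]_7 :=
  Drot l1 l2 - E_ 1 1 - E_ 2 2 + c2 *: E_ 2 7 + E_ 7 7.

Definition D4 (l1 l2 c1 : R) : 'M[R]_7 :=
  Drot l1 l2 + c1 *: E_ 1 7 + E_ 2 7.

Definition D5 (l1 l2 : R) : 'M[R]_7 := Drot l1 l2 + E_ 1 7.

Definition D6 (l1 l2 : R) : 'M[R]_7 := Drot l1 l2.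

Definition mx_of_rows (s : seq (seq R)) : 'M[R]_7 :=
  \matrix_(i < 7, j < 7) (nth [::] s i)`_j.

Definition Db (l : R) : 'M[R]_7 := mx_of_rows
  [:: [:: 0; 0; 0; -1;  0; 0; 0];
      [:: 0; 0; 1;  0;  0; 0; 0];
      [:: 0; 0; 0;  0;  0; 0; 1];
      [:: 0; 0; 0;  0;  0; 0; 0];
      [:: 0; 0; 0;  0;  0; l; 0];
      [:: 0; 0; 0;  0; -l; 0; 0];
      [:: 0; 0; 0;  0;  0; 0; 0]].

Definition Dc (x l : R) : 'M[R]_7 := mx_of_rows
  [:: [:: 0; 0; 0; -x;  0; 0; 0];
      [:: 0; 0; x;  0;  0; 0; 1];
      [:: 0; 0; 0;  0;  0; 0; x];
      [:: 0; 0; 0;  0;  0; 0; 0];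
      [:: 0; 0; 0;  0;  0; l; 0];
      [:: 0; 0; 0;  0; -l; 0; 0];
      [:: 0; 0; 0;  0;  0; 0; 0]].

Definition case_a (D : 'M[R]_7) : Prop :=
  exists l1 l2 : R,
    [\/ exists c2 : R, D = D1 l1 l2 c2,
        exists c1 : R, D = D4 l1 l2 c1,
        D = D5 l1 l2
      | D = D6 l1 l2].

Definition case_b (D : 'M[R]_7) : Prop := exists2 l : R, 0 <= l & D = Db l.

Definition case_c (D : 'M[R]_7) : Prop :=
  exists x l : R, 0 <= x /\ D = Dc x l.

End Model.

(* Main.v *)
From HB Require Import structures.
Require Import Defs.
From mathcomp Require Import all_boot all_order all_algebra reals.
From mathcomp Require Import ring.

Set Implicit Arguments.
Unset Strict Implicit.
Unset Printing Implicit Defensive.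

Import Order.TTheory GRing.Theory Num.Theory.
Local Open Scope ring_scope.

(** Write [h^⊥ = <e1>], [e2 = J e1], so that [h = e1^⊥], and let [e7, e8 = J e7]
    be a null pair dual to [e1, e2]: [g e1 e8 = 1], [g e2 e7 = -1].  Since
    [span (e1, e2)] is isotropic, the metric has signature (2,2) on
    [span (e1, e2, e7, e8)], hence it is positive definite on the orthogonal
    complement [S] of that space ([isotropic_complement_positive]), which a
    unitary pair [e3, e5] spans over the complex numbers.

    The bracket is determined by [D = ad e8] on [h].  On the complex subspace
    [h ∩ J h = span (e1, .., e6)], integrability says that [D] commutes with
    [J]; closedness of omega says that [D] is infinitesimally symplectic on [h],
    and together these make [D] skew for [g].  Reading off matrix entries,
    [D] depends on eleven real numbers only ([frame_isomorphic]):
    - a real [a], with [D = a] on [span (e1, e2)] and [D e7 = - a e7] modulo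
      [span (e1, .., e6)];
    - an operator [A] of u(2), the action of [D] on [S];
    - the component [w] of [D e7] in [S], which also determines the
      [span (e1, e2)]-component of [D] on [S];
    - the components [c1, c2] of [D e7] on [e1, e2].

    Three changes of frame remain, each realised as an explicit unitary map of
    the model space: multiplication of [e1] by a real [t <> 0] and of [e7] by
    [1 / t] ([Dgen_scale]), a unitary change of [e3, e5] ([Dgen_unitary]), and
    the shift of [e7] by some [v] in [S], corrected inside [span (e1, e2)] so
    that [e7] stays null ([Dgen_shift]).  The shift replaces [w] by
    [w + (A + a) v] and leaves [c2] alone.

    Now diagonalise [A].  As [A] is skew, a shift makes [(A + a) w = 0], with
    [w = 0] if [a <> 0].  If [a <> 0], a further shift kills [c1], and scaling to
    [a = -1] gives [D_1].  If [a = 0] and [w = 0], scaling multiplies [(c1, c2)]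
    by an arbitrary nonzero cube and gives [D_4], [D_5] or [D_6].  If [a = 0] and
    [w <> 0], then [A w = 0]: one takes [e3] along [w], kills [c1] by a shift
    along [J e3], and scales [c2] to 1 (case (c)), or, if [c2 = 0], scales [w] to
    [e3] (case (b)). *)

(** * Coordinates on the model space *)

Section ModelCoordinates.
Variable R : realType.
Implicit Types (x : 'rV[R]_8) (D : 'M[R]_7).

Definition row8 (x1 x2 x3 x4 x5 x6 x7 x8 : R) : 'rV[R]_8 :=
  \row_i nth 0 [:: x1; x2; x3; x4; x5; x6; x7; x8] i.

Lemma row8E (x1 x2 x3 x4 x5 x6 x7 x8 : R) :
  let x := row8 x1 x2 x3 x4 x5 x6 x7 x8 in
  (x 0 (ix 1) = x1) * (x 0 (ix 2) = x2) * (x 0 (ix 3) = x3) *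
  (x 0 (ix 4) = x4) * (x 0 (ix 5) = x5) * (x 0 (ix 6) = x6) *
  (x 0 (ix 7) = x7) * (x 0 (ix 8) = x8).
Proof. by do !split; rewrite mxE. Qed.

Lemma ord8_ind (P : 'I_8 -> Prop) :
  P (ix 1) -> P (ix 2) -> P (ix 3) -> P (ix 4) ->
  P (ix 5) -> P (ix 6) -> P (ix 7) -> P (ix 8) -> forall i, P i.
Proof.
move=> P1 P2 P3 P4 P5 P6 P7 P8 i.
have -> : i = ix i.+1 by apply: val_inj; rewrite /= modn_small.
by case: i; do 8?case=> //.
Qed.

Lemma ord7_ind (P : 'I_7 -> Prop) :
  P (ix 1) -> P (ix 2) -> P (ix 3) -> P (ix 4) ->
  P (ix 5) -> P (ix 6) -> P (ix 7) -> forall i, P i.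
Proof.
move=> P1 P2 P3 P4 P5 P6 P7 i.
have -> : i = ix i.+1 by apply: val_inj; rewrite /= modn_small.
by case: i; do 7?case=> //.
Qed.

Lemma sum8 (M : nmodType) (F : 'I_8 -> M) :
  \sum_i F i = F (ix 1) + F (ix 2) + F (ix 3) + F (ix 4) +
               F (ix 5) + F (ix 6) + F (ix 7) + F (ix 8).
Proof.
do 8!rewrite big_ord_recr /=; rewrite big_ord0 add0r.
by do !congr (_ + _); congr (F _); apply: val_inj.
Qed.

(** The block decomposition defining [model_ad] lives on ['I_(7 + 1)]; this
    states its entries with the one-based indices used everywhere else. *)
Lemma model_adE D (i j : nat) : (0 < i < 9)%N -> (0 < j < 9)%N ->
  model_ad D (ix i) (ix j) =
  if (i < 8)%N && (j < 8)%N then D (ix i) (ix j) else 0.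
Proof.
have ixl k : (0 < k < 8)%N -> ix k = lshift 1 (ix k : 'I_7) :> 'I_(7 + 1).
  case: k => // k; rewrite ltnS => k8; apply: val_inj.
  by rewrite /= !modn_small // ltnW.
have ixr : ix 8 = rshift 7 (0 : 'I_1) :> 'I_(7 + 1) by apply: val_inj.
move=> /andP[i0]; rewrite ltnS leq_eqVlt => /orP[/eqP->|i8];
move=> /andP[j0]; rewrite ltnS leq_eqVlt => /orP[/eqP->|j8]; rewrite /model_ad.
- by rewrite ixr; apply: etrans (block_mxEdr D 0 0 (0 : 'M_1) 0 0) _; rewrite mxE.
- rewrite ixr ixl ?j0 //.
  by apply: etrans (block_mxEdl D 0 0 (0 : 'M_1) 0 _) _; rewrite mxE.
- rewrite ixr ixl ?i0 // andbF.
  by apply: etrans (block_mxEur D 0 0 (0 : 'M_1) _ 0) _; rewrite mxE.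
- by rewrite !ixl ?i0 ?j0 // i8 j8; apply: (block_mxEul D 0 0 (0 : 'M_1)).
Qed.

Lemma model_JE x : model_J R x =
  row8 (- x 0 (ix 2)) (x 0 (ix 1)) (- x 0 (ix 4)) (x 0 (ix 3))
       (- x 0 (ix 6)) (x 0 (ix 5)) (- x 0 (ix 8)) (x 0 (ix 7)).
Proof.
have xE i j : x *m delta_mx i j = x 0 i *: delta_mx 0 j.
  apply/rowP => k; rewrite !mxE (bigD1 i) //= big1 => [|l /negPf li].
    by rewrite mxE !eqxx addr0.
  by rewrite mxE li mulr0.
rewrite lfunE /= unlock /= addr0 !(mulmxDr, mulmxBr, mulmxN) !xE.
by apply/rowP; elim/ord8_ind; rewrite row8E !mxE /=; ring.
Qed.

(** [ad e8] on [h] in an arbitrary adapted frame.  With [S = span (e3, .., e6)]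
    identified to the plane [C^2] by [e4 = i e3] and [e6 = i e5], the middle block
    is the general skew-Hermitian operator [A] of that plane, with diagonal
    entries [- i l1], [- i l2] and upper right entry [m + i n].  The entries
    [w3, .., w6] in the first two rows are forced by those of the last column:
    [D v = A v + g (J v) w e1 + g v w e2] for [v] in [S]. *)
Definition Dgen (a l1 l2 m n c1 c2 w3 w4 w5 w6 : R) : 'M[R]_7 := mx_of_rows
  [:: [:: a; 0;  w4; -w3;  w6; -w5; c1];
      [:: 0; a;  w3;  w4;  w5;  w6; c2];
      [:: 0; 0;   0;  l1;   m;  -n; w3];
      [:: 0; 0; -l1;   0;   n;   m; w4];
      [:: 0; 0;  -m;  -n;   0;  l2; w5];
      [:: 0; 0;   n;  -m; -l2;   0; w6];
      [:: 0; 0;   0;   0;   0;   0; -a]].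

(** Reduces a statement on row vectors to eight scalar variables, so that the
    identities below become polynomial identities. *)
Lemma row8_ind (P : 'rV[R]_8 -> Prop) :
  (forall x1 x2 x3 x4 x5 x6 x7 x8 : R, P (row8 x1 x2 x3 x4 x5 x6 x7 x8)) ->
  forall x, P x.
Proof.
move=> Prow x.
have -> : x = row8 (x 0 (ix 1)) (x 0 (ix 2)) (x 0 (ix 3)) (x 0 (ix 4))
                   (x 0 (ix 5)) (x 0 (ix 6)) (x 0 (ix 7)) (x 0 (ix 8)).
  by apply/rowP; elim/ord8_ind; rewrite row8E.
exact: Prow.
Qed.

Section Row8.
Variables (c x1 x2 x3 x4 x5 x6 x7 x8 y1 y2 y3 y4 y5 y6 y7 y8 : R).
Let x := row8 x1 x2 x3 x4 x5 x6 x7 x8.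
Let y := row8 y1 y2 y3 y4 y5 y6 y7 y8.

Lemma row8Z : c *: x =
  row8 (c * x1) (c * x2) (c * x3) (c * x4) (c * x5) (c * x6) (c * x7) (c * x8).
Proof. by apply/rowP; elim/ord8_ind; rewrite mxE !row8E. Qed.

Lemma row8D : x + y =
  row8 (x1 + y1) (x2 + y2) (x3 + y3) (x4 + y4)
       (x5 + y5) (x6 + y6) (x7 + y7) (x8 + y8).
Proof. by apply/rowP; elim/ord8_ind; rewrite mxE !row8E. Qed.

Lemma model_J_row8 : model_J R x = row8 (- x2) x1 (- x4) x3 (- x6) x5 (- x8) x7.
Proof. by rewrite model_JE !row8E. Qed.

Lemma model_metric_row8 : model_metric x y =
  x1 * y8 + x8 * y1 - (x2 * y7 + x7 * y2)
  + (x3 * y3 + x4 * y4 + x5 * y5 + x6 * y6).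
Proof. by rewrite model_metricE !row8E. Qed.

Lemma Dgen_row8 (a l1 l2 m n c1 c2 w3 w4 w5 w6 : R) :
  x *m (model_ad (Dgen a l1 l2 m n c1 c2 w3 w4 w5 w6))^T =
  row8 (a * x1 + w4 * x3 - w3 * x4 + w6 * x5 - w5 * x6 + c1 * x7)
       (a * x2 + w3 * x3 + w4 * x4 + w5 * x5 + w6 * x6 + c2 * x7)
       (l1 * x4 + m * x5 - n * x6 + w3 * x7)
       (- l1 * x3 + n * x5 + m * x6 + w4 * x7)
       (- m * x3 - n * x4 + l2 * x6 + w5 * x7)
       (n * x3 - m * x4 - l2 * x5 + w6 * x7)
       (- a * x7) 0.
Proof.
have tr (A : 'M[R]_8) i j : A^T i j = A j i by rewrite mxE.
have DE i j : Dgen a l1 l2 m n c1 c2 w3 w4 w5 w6 (ix i) (ix j) =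
  (nth [::] _ (ix i))`_(ix j) := mxE _ _ _ _.
rewrite /x; apply/rowP.
by elim/ord8_ind; rewrite row8E mxE sum8 !tr !row8E !model_adE //= ?DE /=; ring.
Qed.

End Row8.

End ModelCoordinates.

(** * Unitary isomorphisms between models *)

Section Isomorphisms.
Variable R : realType.

Lemma unitary_Lie_isomorphic_trans (U V W : vectType R)
    (bU : lieBracket U) (JU : 'End(U)) (gU : {symmetric U})
    (bV : lieBracket V) (JV : 'End(V)) (gV : {symmetric V})
    (bW : lieBracket W) (JW : 'End(W)) (gW : {symmetric W}) :
  unitary_Lie_isomorphic bU JU gU bV JV gV ->
  unitary_Lie_isomorphic bV JV gV bW JW gW ->
  unitary_Lie_isomorphic bU JU gU bW JW gW.
Proof.
move=> [f [f_bij fb fJ fg]] [k [k_bij kb kJ kg]].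
exists (k \o f)%VF; split=> [|x y|x|x y]; rewrite ?comp_lfunE.
- by apply: (eq_bij (bij_comp k_bij f_bij)) => x; rewrite comp_lfunE.
- by rewrite fb kb.
- by rewrite fJ kJ.
- by rewrite kg fg.
Qed.

Lemma injective_bijective (V W : vectType R) (f : 'Hom(V, W)) :
  \dim {:V} = \dim {:W} -> (forall x, f x = 0 -> x = 0) -> bijective f.
Proof.
move=> dimE f0.
have kf : lker f == 0%VS.
  by rewrite -subv0; apply/subvP => x /[!memv_ker] /eqP /f0 ->; rewrite mem0v.
have imf : limg f = fullv.
  apply/eqP; rewrite eqEdim subvf /= -dimE.
  by rewrite -(limg_ker_dim f fullv) (eqP kf) capv0 dimv0.
exists f^-1%VF; first exact: lker0_lfunK.
by move=> y; apply: limg_lfunVK; rewrite imf memvf.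
Qed.

Lemma model_metric_nondegenerate (x : 'rV[R]_8) :
  (forall y, model_metric x y = 0) -> x = 0.
Proof.
move=> x0; apply/rowP; elim/ord8_ind; rewrite mxE.
- by rewrite -[RHS](x0 (row8 0 0 0 0 0 0 0 1)) model_metricE !row8E; ring.
- rewrite -[RHS]oppr0 -[X in - X](x0 (row8 0 0 0 0 0 0 1 0)).
  by rewrite model_metricE !row8E; ring.
- by rewrite -[RHS](x0 (row8 0 0 1 0 0 0 0 0)) model_metricE !row8E; ring.
- by rewrite -[RHS](x0 (row8 0 0 0 1 0 0 0 0)) model_metricE !row8E; ring.
- by rewrite -[RHS](x0 (row8 0 0 0 0 1 0 0 0)) model_metricE !row8E; ring.
- by rewrite -[RHS](x0 (row8 0 0 0 0 0 1 0 0)) model_metricE !row8E; ring.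
- rewrite -[RHS]oppr0 -[X in - X](x0 (row8 0 1 0 0 0 0 0 0)).
  by rewrite model_metricE !row8E; ring.
- by rewrite -[RHS](x0 (row8 1 0 0 0 0 0 0 0)) model_metricE !row8E; ring.
Qed.

Definition model_isomorphic (D D' : 'M[R]_7) : Prop :=
  unitary_Lie_isomorphic (model_bracket D) (model_J R) (model_g R)
    (model_bracket D') (model_J R) (model_g R).

(** A unitary map [f] intertwines the brackets as soon as it scales the [e8]
    coordinate by [t] and intertwines [ad e8] with [t *: ad e8], up to a
    correction proportional to the [e8] coordinate: such a term cancels in
    [x8 *: f (D y) - y8 *: f (D x)].  The correction by [u] allows [f e8] to have
    components in [h]. *)
Lemma model_isomorphicP (D D' : 'M[R]_7) (t : R) (u : 'rV[R]_8)
    (f : 'rV[R]_8 -> 'rV[R]_8) :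
  linear f ->
  (forall x, f x 0 (ix 8) = t * x 0 (ix 8)) ->
  (forall x, f (x *m (model_ad D)^T) =
     t *: ((f x - x 0 (ix 8) *: u) *m (model_ad D')^T)) ->
  (forall x, f (model_J R x) = model_J R (f x)) ->
  (forall x y, model_metric (f x) (f y) = model_metric x y) ->
  model_isomorphic D D'.
Proof.
move=> flin f8 fad fJ fg.
pose fL : {linear 'rV[R]_8 -> 'rV[R]_8} :=
  HB.pack f (GRing.isLinear.Build _ _ _ _ f flin).
have fE x : linfun fL x = f x by rewrite lfunE.
exists (linfun fL); split=> [|x y|x|x y]; rewrite ?fE //; last exact: fg.
  apply: injective_bijective => // x; rewrite fE => fx0.
  apply: model_metric_nondegenerate => y; rewrite -fg fx0.
  exact: (linear0l (model_g R)).
have fBZ (c d : R) w z : f (c *: w - d *: z) = c *: f w - d *: f z.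
  by have := linearB fL (c *: w) (d *: z); rewrite !linearZ.
rewrite /= /model_bracket_fun fBZ !fad !f8 !mulmxBl -!scalemxAl.
by apply/rowP => i; rewrite !mxE; ring.
Qed.

End Isomorphisms.

(** * The three changes of frame *)

Section Moves.
Variable R : realType.

(** New frame [t *: e1, e3, e5, t^-1 *: e7], hence [ad e8] is divided by [t]. *)
Lemma Dgen_scale (a l1 l2 m n c1 c2 w3 w4 w5 w6 t : R) : t != 0 ->
  model_isomorphic (Dgen a l1 l2 m n c1 c2 w3 w4 w5 w6)
    (Dgen (a / t) (l1 / t) (l2 / t) (m / t) (n / t) (c1 / t ^+ 3) (c2 / t ^+ 3)
       (w3 / t ^+ 2) (w4 / t ^+ 2) (w5 / t ^+ 2) (w6 / t ^+ 2)).
Proof.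
move=> t0.
pose f (x : 'rV[R]_8) := row8 (x 0 (ix 1) / t) (x 0 (ix 2) / t)
  (x 0 (ix 3)) (x 0 (ix 4)) (x 0 (ix 5)) (x 0 (ix 6))
  (t * x 0 (ix 7)) (t * x 0 (ix 8)).
have fE x1 x2 x3 x4 x5 x6 x7 x8 : f (row8 x1 x2 x3 x4 x5 x6 x7 x8) =
    row8 (x1 / t) (x2 / t) x3 x4 x5 x6 (t * x7) (t * x8).
  by rewrite /f !row8E.
apply: (@model_isomorphicP _ _ _ t 0 f) => [c x y|x|x|x|x y].
- elim/row8_ind: x => *; elim/row8_ind: y => *.
  by rewrite !(fE, row8Z, row8D); congr row8; field.
- by elim/row8_ind: x => *; rewrite fE !row8E.
- elim/row8_ind: x => *; rewrite scaler0 subr0 !(fE, Dgen_row8, row8Z).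
  by congr row8; field.
- elim/row8_ind: x => *.
  by rewrite !(fE, model_J_row8); congr row8; field.
- elim/row8_ind: x => *; elim/row8_ind: y => *.
  by rewrite !(fE, model_metric_row8); field.
Qed.

(** New vector [e7 + v + (g v v / 2) *: e2 + p *: e1], where
    [v = v3 *: e3 + v4 *: e4 + v5 *: e5 + v6 *: e6].  As [h] is abelian, [ad e8]
    is unchanged on [h]; only its coordinates change, [w] into [w + (A + a) v]
    and [c1] into [c1 + 2 g (J v) w + g (A v) (J v) + 2 p a]. *)
Lemma Dgen_shift (a l1 l2 c1 c2 w3 w4 w5 w6 v3 v4 v5 v6 p : R) :
  model_isomorphic (Dgen a l1 l2 0 0 c1 c2 w3 w4 w5 w6)
    (Dgen a l1 l2 0 0
       (c1 + (v3 * w4 - v4 * w3 + v5 * w6 - v6 * w5) *+ 2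
        - l1 * (v3 ^+ 2 + v4 ^+ 2) - l2 * (v5 ^+ 2 + v6 ^+ 2) + a * p *+ 2) c2
       (w3 + a * v3 + l1 * v4) (w4 + a * v4 - l1 * v3)
       (w5 + a * v5 + l2 * v6) (w6 + a * v6 - l2 * v5)).
Proof.
pose q := (v3 ^+ 2 + v4 ^+ 2 + v5 ^+ 2 + v6 ^+ 2) / 2.
have qE : v3 ^+ 2 = q *+ 2 - v4 ^+ 2 - v5 ^+ 2 - v6 ^+ 2 by rewrite /q; field.
(* Old coordinates to new ones: the old basis vectors are the new ones shifted
   by - v and - p, whence the signs. *)
pose F x1 x2 x3 x4 x5 x6 x7 x8 : 'rV[R]_8 :=
  row8 (x1 - v4 * x3 + v3 * x4 - v6 * x5 + v5 * x6 - p * x7 - q * x8)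
    (x2 - v3 * x3 - v4 * x4 - v5 * x5 - v6 * x6 + q * x7 - p * x8)
    (x3 - v3 * x7 + v4 * x8) (x4 - v4 * x7 - v3 * x8)
    (x5 - v5 * x7 + v6 * x8) (x6 - v6 * x7 - v5 * x8) x7 x8.
pose f (x : 'rV[R]_8) := F (x 0 (ix 1)) (x 0 (ix 2)) (x 0 (ix 3)) (x 0 (ix 4))
  (x 0 (ix 5)) (x 0 (ix 6)) (x 0 (ix 7)) (x 0 (ix 8)).
have fE x1 x2 x3 x4 x5 x6 x7 x8 : f (row8 x1 x2 x3 x4 x5 x6 x7 x8) =
    F x1 x2 x3 x4 x5 x6 x7 x8.
  by rewrite /f !row8E.
(* The fixed vector is the component in h of the image of e8. *)
apply: (@model_isomorphicP _ _ _ 1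
  (row8 (- q) (- p) v4 (- v3) v6 (- v5) 0 0) f) => [c x y|x|x|x|x y].
- elim/row8_ind: x => *; elim/row8_ind: y => *.
  by rewrite row8Z row8D !fE row8Z row8D; congr row8; ring.
- by elim/row8_ind: x => *; rewrite fE !row8E mul1r.
- elim/row8_ind: x => *; rewrite scale1r -scaleNr row8E fE /F.
  rewrite row8Z row8D !Dgen_row8 fE.
  by congr row8; ring: qE.
- elim/row8_ind: x => *.
  by rewrite model_J_row8 !fE model_J_row8; congr row8; ring.
- elim/row8_ind: x => *; elim/row8_ind: y => *.
  by rewrite !fE !model_metric_row8; ring: qE.
Qed.

(** New unitary basis [z = (p + i q, r + i s)] and [(- (r - i s), p - i q)] of
    the plane [S]; the formulas are the entries of [U^* A U] and [U^* w] for the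
    matrix [U] of SU(2) with these columns. *)
Lemma Dgen_unitary (a l1 l2 m n c1 c2 w3 w4 w5 w6 p q r s : R) :
  p ^+ 2 + q ^+ 2 + r ^+ 2 + s ^+ 2 = 1 ->
  model_isomorphic (Dgen a l1 l2 m n c1 c2 w3 w4 w5 w6)
    (Dgen a
       (l1 * (p ^+ 2 + q ^+ 2) + l2 * (r ^+ 2 + s ^+ 2)
        - (m * (s * p - r * q) + n * (r * p + s * q)) *+ 2)
       (l1 * (r ^+ 2 + s ^+ 2) + l2 * (p ^+ 2 + q ^+ 2)
        + (m * (s * p - r * q) + n * (r * p + s * q)) *+ 2)
       ((l1 - l2) * (p * s + q * r) + m * (r ^+ 2 - s ^+ 2) - n * r * s *+ 2
        + m * (p ^+ 2 - q ^+ 2) + n * p * q *+ 2)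
       ((l1 - l2) * (p * r - q * s) - n * (r ^+ 2 - s ^+ 2) - m * r * s *+ 2
        + n * (p ^+ 2 - q ^+ 2) - m * p * q *+ 2)
       c1 c2
       (p * w3 + q * w4 + r * w5 + s * w6) (p * w4 - q * w3 + r * w6 - s * w5)
       (p * w5 - q * w6 - r * w3 + s * w4) (p * w6 + q * w5 - r * w4 - s * w3)).
Proof.
move=> nrm.
have nrmE : p ^+ 2 = 1 - q ^+ 2 - r ^+ 2 - s ^+ 2 by rewrite -nrm; ring.
pose F x1 x2 x3 x4 x5 x6 x7 x8 : 'rV[R]_8 :=
  row8 x1 x2
    (p * x3 + q * x4 + r * x5 + s * x6) (p * x4 - q * x3 + r * x6 - s * x5)
    (p * x5 - q * x6 - r * x3 + s * x4) (p * x6 + q * x5 - r * x4 - s * x3)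
    x7 x8.
pose f (x : 'rV[R]_8) := F (x 0 (ix 1)) (x 0 (ix 2)) (x 0 (ix 3)) (x 0 (ix 4))
  (x 0 (ix 5)) (x 0 (ix 6)) (x 0 (ix 7)) (x 0 (ix 8)).
have fE x1 x2 x3 x4 x5 x6 x7 x8 : f (row8 x1 x2 x3 x4 x5 x6 x7 x8) =
    F x1 x2 x3 x4 x5 x6 x7 x8.
  by rewrite /f !row8E.
apply: (@model_isomorphicP _ _ _ 1 0 f) => [c x y|x|x|x|x y].
- elim/row8_ind: x => *; elim/row8_ind: y => *.
  by rewrite row8Z row8D !fE row8Z row8D; congr row8; ring.
- by elim/row8_ind: x => *; rewrite fE !row8E mul1r.
- elim/row8_ind: x => *; rewrite scaler0 subr0 scale1r fE /F !Dgen_row8 fE.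
  by congr row8; ring: nrmE.
- elim/row8_ind: x => *.
  by rewrite model_J_row8 !fE model_J_row8; congr row8; ring.
- elim/row8_ind: x => *; elim/row8_ind: y => *.
  by rewrite !fE !model_metric_row8; ring: nrmE.
Qed.

End Moves.

(** * Orthogonality and signature *)

Section Orthogonality.
Variables (R : realType) (V : vectType R) (g : {symmetric V}).

Lemma symC x y : g x y = g y x.
Proof. by rewrite hermC expr0 mul1r. Qed.

(** A linear form cuts the dimension by at most one. *)
Lemma exists_orthogonal (U : {vspace V}) (s : seq V) :
  (size s < \dim U)%N ->
  exists x, [/\ x \in U, x != 0 & {in s, forall y, g x y = 0}].
Proof.
elim: s U => [|u s IHs] U.
  move=> dimU; exists (vpick U); split=> //; first exact: memv_pick.
  by rewrite vpick0 -dimv_eq0 -lt0n.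
move=> sU; have [|x [/[!memv_cap] /andP[xU /[!mem_orthov1] /eqP xu] x0 xs]] :=
    IHs (U :&: orthov g <[u]>)%VS.
  apply: leq_trans (leq_dim_orthov1 _ _ _).
  by rewrite -ltnS (leq_trans sU) // leqSpred.
exists x; split=> // y; rewrite inE => /predU1P[->//|]; exact: xs.
Qed.

Lemma nondegenerateP :
  nondegenerate g -> forall x, (forall y, g x y = 0) -> x = 0.
Proof.
move=> /eqP g_nd x x0; apply/eqP; rewrite -memv0 -g_nd.
by apply/mem_orthovP => y _.
Qed.

(** If [q] directions are negative, then [q] orthogonality conditions force
    positivity: [s] consists of the negative vectors of a diagonalising basis, so
    a vector orthogonal to [s] lies in the span of the positive ones. *)
Lemma signature_positive (p q : nat) : has_signature g p q ->
  exists s : seq V, size s = q /\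
    forall y, {in s, forall z, g y z = 0} -> y != 0 -> 0 < g y y.
Proof.
move=> [e [e_basis e_orth e_pos e_neg]].
exists [seq tnth e (rshift p i) | i <- enum 'I_q].
split=> [|y ye y0]; first by rewrite size_map size_enum_ord.
have ee i j : g (tnth e i) (tnth e j) = (g (tnth e i) (tnth e i)) *+ (i == j).
  by have [->|ij] := eqVneq i j; [rewrite mulr1n | rewrite e_orth].
have yE : y = \sum_i coord e i y *: tnth e i.
  rewrite {1}(coord_basis e_basis (memvf y)).
  by apply: eq_bigr => i _; rewrite (tnth_nth 0).
have gye i : g y (tnth e i) = coord e i y * g (tnth e i) (tnth e i).
  rewrite {1}yE linear_sumlz (bigD1 i) //= linearZl_LR big1 ?addr0 // => j ji.
  by rewrite linearZl_LR /= ee (negPf ji) mulr0n mulr0.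
have cneg (i : 'I_(p + q)) : (p <= i)%N -> coord e i y = 0.
  move=> pi; have [j iE] : exists j : 'I_q, i = rshift p j.
    have jq : (i - p < q)%N by rewrite ltn_subLR.
    by exists (Ordinal jq); apply: val_inj; rewrite /= subnKC.
  have /eqP : g y (tnth e i) = 0.
    by apply: ye; apply/mapP; exists j; rewrite ?mem_enum ?iE.
  by rewrite gye mulf_eq0 (lt_eqF (e_neg _ pi)) orbF => /eqP.
have gyy : g y y = \sum_i coord e i y ^+ 2 * g (tnth e i) (tnth e i).
  rewrite {2}yE linear_sumr; apply: eq_bigr => i _.
  by rewrite linearZr_LR /= gye mulrA.
have term_ge0 i : 0 <= coord e i y ^+ 2 * g (tnth e i) (tnth e i).
  have [ip|pi] := ltnP i p; first by rewrite mulr_ge0 ?sqr_ge0 // ltW ?e_pos.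
  by rewrite cneg // expr0n mul0r.
rewrite lt_neqAle gyy sumr_ge0 // andbT eq_sym.
apply: contra_neq y0; move/eqP; rewrite psumr_eq0 // => /allP all0.
rewrite yE big1 // => i _; have := all0 i; rewrite mem_index_enum => /(_ isT).
rewrite mulf_eq0 sqrf_eq0 => /orP[/eqP-> |]; first by rewrite scale0r.
have [ip|pi] := ltnP i p; first by rewrite (gt_eqF (e_pos _ _)).
by rewrite cneg // scale0r.
Qed.

End Orthogonality.

(** * Adapted frames *)

Section Frame.
Variables (R : realType) (V : vectType R).
Variables (b : lieBracket V) (J : 'End(V)) (g : {symmetric V}) (h : {vspace V}).
Hypothesis pK : pseudo_Kahler b J g.

Lemma metric_J x y : g (J x) y = - g x (J y).
Proof.
by rewrite -(pK_compatible pK) (pK_complex pK) linearNl.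
Qed.

Lemma metric_xJx x : g x (J x) = 0.
Proof.
have := metric_J x x; rewrite symC => /eqP; rewrite -addr_eq0 -mulr2n.
by rewrite mulrn_eq0 /= => /eqP.
Qed.

(** The products [g x y] and [g x (J y)] of the frame vectors determine all
    products of [e1, J e1, .., e7, J e7]; these are the ones of the model. *)
Record unitary_frame (e1 e3 e5 e7 : V) : Prop := UnitaryFrame {
  uf11 : g e1 e1 = 0; uf33 : g e3 e3 = 1; uf55 : g e5 e5 = 1; uf77 : g e7 e7 = 0;
  uf17 : g e1 e7 = 0; uf18 : g e1 (J e7) = 1;
  uf31 : g e3 e1 = 0; uf32 : g e3 (J e1) = 0;
  uf37 : g e3 e7 = 0; uf38 : g e3 (J e7) = 0;
  uf51 : g e5 e1 = 0; uf52 : g e5 (J e1) = 0;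
  uf57 : g e5 e7 = 0; uf58 : g e5 (J e7) = 0;
  uf53 : g e5 e3 = 0; uf54 : g e5 (J e3) = 0
}.

Hypothesis dimV : \dim {:V} = 8%N.

Lemma exists_normal_vector : (\dim h).+1 = \dim {:V} ->
  exists e1, [/\ e1 != 0, e1 \in orthov g h & forall x, (x \in h) = (g x e1 == 0)].
Proof.
move=> dimh; have [|e1 [_ e10 e1h]] := @exists_orthogonal _ _ g fullv (vbasis h).
  by rewrite size_tuple dimh.
have sub : (h <= orthov g <[e1]>)%VS.
  rewrite -(span_basis (vbasisP h)); apply/span_subvP => x xh.
  by rewrite mem_orthov1 symC e1h.
exists e1; split=> // [|x]; first by rewrite mem_orthov_sym.
rewrite -mem_orthov1; suff -> : h = orthov g <[e1]> by [].
apply/eqP; rewrite eqEdim sub.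
have -> : orthov g <[e1]> = (fullv :&: orthov g <[e1]>)%VS by rewrite capfv.
rewrite -eq_dim_orthov1 -?dimh ?leqnn //.
apply/negP => e1V; case/eqP: e10.
apply: (nondegenerateP (pK_nondegenerate pK)) => y.
by apply: (elimT mem_orthovP e1V); rewrite memvf.
Qed.

(** The vectors [z] and [J z] span a complex line on which the complex-valued
    form [g e1 _ + i g e1 (J _)] is onto, so it takes the value [i] at some [y];
    adding a multiple of [J e1] then makes [y] null. *)
Lemma exists_null_partner e1 : e1 != 0 -> g e1 e1 = 0 ->
  exists e7, [/\ g e1 e7 = 0, g e1 (J e7) = 1 & g e7 e7 = 0].
Proof.
move=> e10 g11.
have [z z1] : exists z, g e1 z != 0.
  have : e1 \notin orthov g fullv by rewrite (eqP (pK_nondegenerate pK)) memv0.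
  by move=> /mem_orthovPn[z _ z1]; exists z.
have [y [y1 y2]] : exists y, g e1 y = 0 /\ g e1 (J y) = 1.
  pose p := g e1 z; pose q := g e1 (J z).
  have pq : p ^+ 2 + q ^+ 2 != 0.
    by rewrite paddr_eq0 ?sqr_ge0 // !sqrf_eq0 negb_and z1.
  exists ((q / (p ^+ 2 + q ^+ 2)) *: z - (p / (p ^+ 2 + q ^+ 2)) *: J z).
  have Jlin c d : J (c *: z - d *: J z) = c *: J z + d *: z.
    by rewrite linearB !linearZ /= (pK_complex pK) opprK.
  rewrite Jlin linearBr linearDr !linearZr_LR /= -/p -/q.
  by split; field.
exists (y + (g y y / 2) *: J e1).
have J1y : g (J e1) y = -1 by rewrite metric_J y2.
have J11 : g (J e1) (J e1) = 0 by rewrite (pK_compatible pK).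
have -> : J (y + (g y y / 2) *: J e1) = J y - (g y y / 2) *: e1.
  by rewrite linearD linearZ /= (pK_complex pK) scalerN.
rewrite !(linearDr, linearDl, linearNr, linearZr_LR, linearZl_LR) /=.
by rewrite y1 y2 g11 metric_xJx J11 [g y (J e1)]symC J1y; split; field.
Qed.

(** If [g x x <= 0], then [g] is negative semidefinite on
    [span (e1, J e1, x)], as [e1, J e1] are null and orthogonal to [x].  By
    dimension count that 3-dimensional space contains a nonzero vector orthogonal
    to the two negative directions, on which [g] has to be positive. *)
Lemma isotropic_complement_positive (e1 e7 x : V) :
  has_signature g 6 2 -> g e1 e1 = 0 -> g e1 e7 = 0 -> g e1 (J e7) = 1 ->
  {in [:: e1; J e1; e7; J e7], forall y, g x y = 0} -> x != 0 -> 0 < g x x.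
Proof.
move=> /signature_positive[s [s2 s_pos]] g11 g17 g18 xperp x0.
have [x1 x2 x7 x8] : [/\ g x e1 = 0, g x (J e1) = 0, g x e7 = 0 & g x (J e7) = 0].
  by split; apply: xperp; rewrite !inE eqxx ?orbT.
have combE al be ga (y := al *: e1 + be *: J e1 + ga *: x) :
    [/\ g y (J e7) = al, g y e7 = - be & g y y = ga ^+ 2 * g x x].
  rewrite /y !(linearDr, linearDl, linearZr_LR, linearZl_LR) /=.
  rewrite !metric_J !(pK_complex pK) !metric_xJx !linearNr /=.
  rewrite !(g11, g17, g18) x1 x2 x7 x8 [g e1 x]symC x1.
  rewrite -(metric_J e1 x) [g (J e1) x]symC x2.
  by split; ring.
pose X := [tuple e1; J e1; x].
have XE k : \sum_(i < 3) k i *: X`_i =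
    k ord0 *: e1 + k (lift ord0 ord0) *: J e1 + k (lift ord0 (lift ord0 ord0)) *: x.
  by rewrite !big_ord_recl big_ord0 addr0 addrA.
have freeX : free X.
  apply/freeP => k; rewrite XE.
  set al := k _; set be := k _; set ga := k _ => comb0.
  have [] := combE al be ga; rewrite comb0 !linear0l => al0 be0 _.
  move: comb0; rewrite -al0 -[be]opprK -be0 oppr0 !scale0r !add0r => /eqP.
  rewrite scaler_eq0 (negPf x0) orbF => /eqP ga0.
  move=> [[|[|[|]]] // ilt]; rewrite (bool_irrelevance ilt isT).
  - by rewrite [RHS]al0; congr k; apply: val_inj.
  - by rewrite -[RHS]oppr0 be0 opprK; congr k; apply: val_inj.
  - by rewrite -[RHS]ga0; congr k; apply: val_inj.
have [|y [yX y0 ys]] := @exists_orthogonal _ _ g <<X>>%VS s.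
  by rewrite s2 (eqnP freeX).
have := s_pos y ys y0; rewrite (coord_span yX) XE.
set al := coord X ord0 y; set be := coord X (lift ord0 ord0) y.
set ga := coord X _ y; have [_ _ ->] := combE al be ga.
have [->|ga0] := eqVneq ga 0; first by rewrite expr0n mul0r ltxx.
by rewrite pmulr_rgt0 // exprn_even_gt0.
Qed.

Lemma exists_unitary_frame (e1 e7 : V) : has_signature g 6 2 ->
  g e1 e1 = 0 -> g e7 e7 = 0 -> g e1 e7 = 0 -> g e1 (J e7) = 1 ->
  exists e3 e5, unitary_frame e1 e3 e5 e7.
Proof.
move=> sgn g11 g77 g17 g18.
have unit_vector s : (size s < 4)%N ->
    exists u, g u u = 1 /\ {in [:: e1, J e1, e7, J e7 & s], forall y, g u y = 0}.
  move=> s4; have [|x [_ x0 xs]] := @exists_orthogonal _ _ g fullv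
    [:: e1, J e1, e7, J e7 & s]; first by rewrite dimV /= !ltnS.
  have xx : 0 < g x x.
    apply: (isotropic_complement_positive sgn g11 g17 g18 _ x0) => y ys.
    by apply: xs; rewrite -[_ :: _]/([:: e1; J e1; e7; J e7] ++ s) mem_cat ys.
  have sx : Num.sqrt (g x x) != 0 by rewrite sqrtr_eq0 -ltNge.
  exists ((Num.sqrt (g x x))^-1 *: x); split=> [|y ys].
    rewrite linearZl_LR linearZr_LR /= -{3}(sqr_sqrtr (ltW xx)).
    by field.
  by rewrite linearZl_LR /= (xs y ys) mulr0.
have [//|e3 [g33 p3]] := unit_vector [::].
have [//|e5 [g55 p5]] := unit_vector [:: e3; J e3].
exists e3, e5; split=> //; do ?[by apply: p3; rewrite !inE eqxx ?orbT
  | by apply: p5; rewrite !inE eqxx ?orbT].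
Qed.

End Frame.

(** * The bracket in an adapted frame *)

Section FrameCoordinates.
Variables (R : realType) (V : vectType R).
Variables (b : lieBracket V) (J : 'End(V)) (g : {symmetric V}) (h : {vspace V}).
Hypotheses (pK : pseudo_Kahler b J g) (dimV : \dim {:V} = 8%N).
Variables (e1 e3 e5 e7 : V).
Hypothesis uf : unitary_frame J g e1 e3 e5 e7.

(** Coordinates in the frame, as products with the dual frame: [J e7] is dual to
    [e1], [- e7] to [J e1], and so on. *)
Definition frame_coord (x : V) : 'rV[R]_8 :=
  row8 (g x (J e7)) (- g x e7) (g x e3) (g x (J e3)) (g x e5) (g x (J e5))
    (- g x (J e1)) (g x e1).

Lemma frame_coord_linear : linear frame_coord.
Proof.
move=> c x y; rewrite /frame_coord row8Z row8D.
by rewrite !linearPl /=; congr row8; ring.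
Qed.

HB.instance Definition _ :=
  GRing.isLinear.Build R V 'rV[R]_8 _ frame_coord frame_coord_linear.

Lemma frame_coord_J x : frame_coord (J x) = model_J R (frame_coord x).
Proof.
rewrite model_J_row8 /frame_coord !(pK_compatible pK) !(metric_J pK).
by congr row8; rewrite opprK.
Qed.

Lemma frame_coordE :
  [/\ frame_coord e1 = row8 1 0 0 0 0 0 0 0,
      frame_coord e3 = row8 0 0 1 0 0 0 0 0,
      frame_coord e5 = row8 0 0 0 0 1 0 0 0 &
      frame_coord e7 = row8 0 0 0 0 0 0 1 0].
Proof.
have gC := symC g.
have gJ := metric_J pK; have gxJx := metric_xJx pK.
have gJC x y : g x (J y) = - g y (J x) by rewrite gC gJ.
case: uf => g11 g33 g55 g77 g17 g18 g31 g32 g37 g38 g51 g52 g57 g58 g53 g54.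
rewrite /frame_coord !gxJx g11 g33 g55 g77 g17 g18 g31 g32 g37 g38.
rewrite g51 g52 g57 g58 g53 g54.
rewrite (gC e1 e3) (gC e1 e5) (gC e3 e5) (gC e7 e1) (gC e7 e3) (gC e7 e5).
rewrite (gJC e1 e3) (gJC e1 e5) (gJC e3 e5) (gJC e7 e1) (gJC e7 e3) (gJC e7 e5).
rewrite g17 g18 g31 g32 g37 g38 g51 g52 g57 g58 g53 g54.
by split; congr row8; ring.
Qed.

Definition frame_vector (i : 'I_8) : V :=
  nth 0 [:: e1; J e1; e3; J e3; e5; J e5; e7; J e7] i.

Lemma frame_coord_vector i : frame_coord (frame_vector i) = delta_mx 0 i.
Proof.
have [f1 f3 f5 f7] := frame_coordE.
elim/ord8_ind: i; rewrite /frame_vector /=;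
  rewrite ?frame_coord_J ?f1 ?f3 ?f5 ?f7 ?model_J_row8;
  by apply/rowP; elim/ord8_ind; rewrite row8E mxE /= ?oppr0.
Qed.

(** [frame_coord] inverts the linear combination map [comb] on one side by
    duality, and [comb] is bijective because it is injective between spaces of
    dimension eight; so it inverts it on both sides. *)
Lemma frame_expansion x : x = \sum_i frame_coord x 0 i *: frame_vector i.
Proof.
pose comb (y : 'rV[R]_8) : V := \sum_i y 0 i *: frame_vector i.
have comb_lin : linear comb.
  move=> c y z; rewrite /comb scaler_sumr -big_split; apply: eq_bigr => i _.
  by rewrite !mxE scalerDl scalerA.
pose cL : {linear 'rV[R]_8 -> V} :=
  HB.pack comb (GRing.isLinear.Build _ _ _ _ comb comb_lin).
have combK y : frame_coord (comb y) = y.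
  rewrite linear_sum [RHS]row_sum_delta; apply: eq_bigr => i _.
  by rewrite linearZ /= frame_coord_vector.
have [|y|k kK Kk] := @injective_bijective R _ _ (linfun cL).
- by rewrite dimV dimvf /dim /= mul1n.
- by rewrite lfunE /= => y0; rewrite -(combK y) y0 linear0.
by rewrite -{1}(Kk x) lfunE /= -[k x in LHS](combK) -[comb (k x)](lfunE cL) Kk.
Qed.

Lemma frame_coord_isometry x y :
  model_metric (frame_coord x) (frame_coord y) = g x y.
Proof.
rewrite {2}(frame_expansion y) sum8 /frame_vector /=.
rewrite !(linearDr, linearZr_LR) /= /frame_coord model_metric_row8 !row8E.
by ring.
Qed.

Lemma frame_coord_bijective : bijective (linfun frame_coord).
Proof.
apply: injective_bijective => [|x]; first by rewrite dimV dimvf /dim /= mul1n.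
rewrite lfunE /= => x0; rewrite (frame_expansion x) x0.
by rewrite big1 // => i _; rewrite mxE scale0r.
Qed.

Hypothesis ab_h : abelian_ideal b h.
Hypothesis hE : forall x, (x \in h) = (g x e1 == 0).

(* [hE] identifies h with e1^⊥, so that conditions [g x e1 = 0] below mean
   x \in h, and conditions [g x e1 = 0], [g x (J e1) = 0] mean that x lies in the
   largest complex subspace of h. *)
Let D := b (J e7).

Lemma lie_antisym x y : b x y = - b y x.
Proof.
have := lie_alt b (y + x).
rewrite !(linearDr, linearDl) /= !lie_alt add0r addr0 => /eqP.
by rewrite addr_eq0 => /eqP.
Qed.

Lemma abelian_normal x y : g x e1 = 0 -> g y e1 = 0 -> b x y = 0.
Proof. by move=> x1 y1; apply: (proj2 ab_h); rewrite hE ?x1 ?y1. Qed.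

Lemma ad_normal x : g x e1 = 0 -> g (D x) e1 = 0.
Proof.
by move=> x1; apply/eqP; rewrite -hE; apply: (proj1 ab_h); rewrite hE x1.
Qed.

(** Closedness of omega on [(e8, x, y)], where [[x, y] = 0]. *)
Lemma ad_symplectic x y : g x e1 = 0 -> g y e1 = 0 ->
  g (J (D x)) y = - g (J x) (D y).
Proof.
move=> x1 y1; have := pK_closed pK (J e7) x y.
rewrite /= (abelian_normal x1 y1) (lie_antisym y).
rewrite !linear0 linear0l addr0 linearN linearNl /= -/D.
rewrite (metric_J pK (D y)) (symC g (D y)) opprK => /eqP.
by rewrite addr_eq0 => /eqP.
Qed.

(** Integrability on [(e8, x)]: the brackets with [J e8 = - e7] vanish, since
    [e7], [x] and [J x] all lie in the abelian ideal. *)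
Lemma ad_complex x : g x e1 = 0 -> g x (J e1) = 0 -> D (J x) = J (D x).
Proof.
move=> x1 x2; have := pK_integrable pK (J e7) x.
have Jx1 : g (J x) e1 = 0 by rewrite (metric_J pK) x2 oppr0.
have e71 : g (- e7) e1 = 0 by rewrite linearNl /= symC (uf17 uf) oppr0.
rewrite (pK_complex pK) (abelian_normal e71 x1) (abelian_normal e71 Jx1).
rewrite linear0 addr0 subr0 -/D.
by move/eqP; rewrite addr_eq0 => /eqP ->; rewrite linearN /= (pK_complex pK) opprK.
Qed.

(** [D] preserves the largest complex subspace of [h], since both [D x] and
    [J (D x) = D (J x)] lie in [h]. *)
Lemma ad_screen x : g x e1 = 0 -> g x (J e1) = 0 -> g (D x) (J e1) = 0.
Proof.
move=> x1 x2; rewrite -[LHS]opprK -(metric_J pK) -ad_complex // ad_normal ?oppr0 //.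
by rewrite (metric_J pK) x2 oppr0.
Qed.

(** [D] is symplectic and commutes with [J] on the complex subspace; only [y]
    has to lie there, which allows [x = e7] below. *)
Lemma ad_skew x y : g x e1 = 0 -> g y e1 = 0 -> g y (J e1) = 0 ->
  g (D x) y = - g x (D y).
Proof.
move=> x1 y1 y2; rewrite -[LHS](pK_compatible pK) ad_symplectic //.
  by rewrite ad_complex // (pK_compatible pK).
by rewrite (metric_J pK) y2 oppr0.
Qed.

Lemma bracket_ad x y : b x y = g x e1 *: D y - g y e1 *: D x.
Proof.
have inh z : z - g z e1 *: J e7 \in h.
  rewrite hE linearBl linearZl_LR /= [g (J e7) e1]symC (uf18 uf) mulr1.
  by rewrite subrr.
have := proj2 ab_h _ _ (inh x) (inh y).
rewrite !(linearBl, linearBr, linearZl_LR, linearZr_LR) /= lie_alt -/D.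
rewrite (lie_antisym x (J e7)) -/D !scaler0 subr0 scalerN opprK => /eqP.
by rewrite subr_eq0 => /eqP <-; rewrite addrK.
Qed.

(** The parameters are the products of [D e7], [D e3], [D e5] with the
    frame that skewness leaves free; every other product reduces to them by moving
    [D] across ([ad_skew]) or [J] out ([ad_complex]).  The even-numbered basis
    vectors then follow by applying [J]. *)
Lemma frame_isomorphic : exists a l1 l2 m n c1 c2 w3 w4 w5 w6,
  unitary_Lie_isomorphic b J g
    (model_bracket (Dgen a l1 l2 m n c1 c2 w3 w4 w5 w6)) (model_J R) (model_g R).
Proof.
pose a := g (D e7) (J e1).
pose c1 := g (D e7) (J e7); pose c2 := - g (D e7) e7.
pose w3 := g (D e7) e3; pose w4 := g (D e7) (J e3).
pose w5 := g (D e7) e5; pose w6 := g (D e7) (J e5).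
pose l1 := - g (D e3) (J e3); pose l2 := - g (D e5) (J e5).
pose m := - g (D e3) e5; pose n := g (D e3) (J e5).
exists a, l1, l2, m, n, c1, c2, w3, w4, w5, w6.
have gC := symC g; have gJ := metric_J pK; have gxJx := metric_xJx pK.
have [g11 _ _ _ g17 g18 g31 g32 _ _ g51 g52 _ _ _ _] := uf.
have g12 : g e1 (J e1) = 0 := gxJx e1.
have g71 : g e7 e1 = 0 by rewrite gC.
have screen x : g x e1 = 0 -> g x (J e1) = 0 ->
    g (J x) e1 = 0 /\ g (J x) (J e1) = 0.
  by move=> x1 x2; rewrite gJ x2 oppr0 (pK_compatible pK) x1.
have [g21 g22] := screen _ g11 g12.
have [g41 g42] := screen _ g31 g32.
have [g61 g62] := screen _ g51 g52.
have skew_e7 x : g x e1 = 0 -> g x (J e1) = 0 -> g (D x) e7 = - g (D e7) x.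
  by move=> x1 x2; rewrite (ad_skew g71 x1 x2) opprK gC.
have skew_e8 x : g x e1 = 0 -> g x (J e1) = 0 -> g (D x) (J e7) = g (D e7) (J x).
  move=> x1 x2; have [Jx1 Jx2] := screen _ x1 x2.
  by rewrite -[LHS]opprK -gJ -ad_complex // skew_e7 // opprK.
have De1 : frame_coord (D e1) = row8 a 0 0 0 0 0 0 0.
  rewrite /frame_coord skew_e8 // skew_e7 // !ad_normal // (ad_screen g11 g12).
  have skew1 x : g x e1 = 0 -> g x (J e1) = 0 -> g (D e1) x = 0.
    by move=> x1 x2; rewrite ad_skew // gC ad_normal ?oppr0.
  by rewrite !skew1 // !oppr0.
have De3 : frame_coord (D e3) = row8 w4 w3 0 (- l1) (- m) n 0 0.
  rewrite /frame_coord skew_e8 // skew_e7 // !ad_normal // (ad_screen g31 g32).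
  have skew3 : g (D e3) e3 = 0.
    have := ad_skew g31 g31 g32; rewrite [g e3 _]gC => /eqP.
    by rewrite -addr_eq0 -mulr2n mulrn_eq0 => /eqP.
  by rewrite skew3 !opprK oppr0.
have De5 : frame_coord (D e5) = row8 w6 w5 m n 0 (- l2) 0 0.
  rewrite /frame_coord skew_e8 // skew_e7 // !ad_normal // (ad_screen g51 g52).
  have skew5 : g (D e5) e5 = 0.
    have := ad_skew g51 g51 g52; rewrite [g e5 _]gC => /eqP.
    by rewrite -addr_eq0 -mulr2n mulrn_eq0 => /eqP.
  rewrite skew5 !opprK oppr0 (ad_skew g51 g31 g32) (ad_skew g51 g41 g42).
  rewrite (ad_complex g31 g32) -gJ (gC (J e5)) (gC e5).
  by [].
have De7 : frame_coord (D e7) = row8 c1 c2 w3 w4 w5 w6 (- a) 0.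
  by rewrite /frame_coord ad_normal.
have De2 : frame_coord (D (J e1)) = row8 0 a 0 0 0 0 0 0.
  by rewrite (ad_complex g11 g12) frame_coord_J De1 model_J_row8 oppr0.
have De4 : frame_coord (D (J e3)) = row8 (- w3) w4 l1 0 (- n) (- m) 0 0.
  by rewrite (ad_complex g31 g32) frame_coord_J De3 model_J_row8 opprK oppr0.
have De6 : frame_coord (D (J e5)) = row8 (- w5) w6 (- n) m l2 0 0 0.
  by rewrite (ad_complex g51 g52) frame_coord_J De5 model_J_row8 opprK oppr0.
have De8 : frame_coord (D (J e7)) = 0 by rewrite /D lie_alt linear0.
have adE x : frame_coord (D x) =
    frame_coord x *m (model_ad (Dgen a l1 l2 m n c1 c2 w3 w4 w5 w6))^T.
  rewrite {1}(frame_expansion x); elim/row8_ind: (frame_coord x) => *.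
  rewrite Dgen_row8 sum8 !row8E /frame_vector /= /D.
  rewrite !(linearDr, linearZr_LR) /= !(linearD, linearZ) /= -/D.
  rewrite De1 De2 De3 De4 De5 De6 De7 De8 scaler0 addr0.
  by rewrite !row8Z !row8D; congr row8; ring.
have fE x : linfun frame_coord x = frame_coord x by rewrite lfunE.
exists (linfun frame_coord); split=> [|x y|x|x y]; rewrite ?fE /=.
- exact: frame_coord_bijective.
- rewrite bracket_ad linearB !linearZ /= !adE /model_bracket_fun.
  by rewrite scalerN /frame_coord !row8E.
- exact: frame_coord_J.
- exact: frame_coord_isometry.
Qed.

End FrameCoordinates.

(** * Normal forms *)

Section Classification.
Variable R : realType.

Lemma Dgen_diag (a l1 l2 c1 c2 : R) :
  Dgen a l1 l2 0 0 c1 c2 0 0 0 0 =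
  Drot l1 l2 + a *: delta_mx (ix 1) (ix 1) + a *: delta_mx (ix 2) (ix 2)
  - a *: delta_mx (ix 7) (ix 7)
  + c1 *: delta_mx (ix 1) (ix 7) + c2 *: delta_mx (ix 2) (ix 7).
Proof.
by apply/matrixP => i j; elim/ord7_ind: i; elim/ord7_ind: j; rewrite !mxE /=; ring.
Qed.

Lemma Dgen_Db (l : R) : Dgen 0 0 l 0 0 0 0 1 0 0 0 = Db l.
Proof. by rewrite /Dgen /Db oppr0. Qed.

Lemma Dgen_Dc (x l : R) : Dgen 0 0 l 0 0 0 1 x 0 0 0 = Dc x l.
Proof. by rewrite /Dgen /Dc oppr0. Qed.

(** Scaling by [t] divides [c1, c2] by [t ^+ 3], so any nonzero value can be
    brought to 1. *)
Lemma cube_root (K : rcfType) (c : K) : exists t : K, t ^+ 3 = c.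
Proof.
wlog c0 : c / 0 <= c => [rootp|].
  have [/rootp //|/ltW cneg] := leP 0 c.
  have [|t tc] := rootp (- c); first by rewrite oppr_ge0.
  by exists (- t); rewrite -[RHS]opprK -tc; ring.
have [||t _ /rootP] := @poly_ivt K ('X^3 - c%:P) 0 (1 + c).
- by rewrite addr_ge0.
- rewrite !hornerE expr0n sub0r oppr_le0 c0 subr_ge0 /=.
  rewrite -subr_ge0 [leRHS](_ : _ = c ^+ 3 + 3 * c ^+ 2 + 2 * c + 1); last by ring.
  by rewrite !addr_ge0 ?mulr_ge0 ?exprn_ge0.
by rewrite !hornerE => /eqP; rewrite subr_eq0 => /eqP <-; exists t.
Qed.

(** Skew-Hermitian 2 x 2 matrices are unitarily diagonalisable.  The three
    equations below say that [z = (p + i q, r + i s)] is a unit eigenvector. *)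
Lemma Dgen_diagonalize (a l1 l2 m n c1 c2 w3 w4 w5 w6 : R) :
  exists l1' l2' w3' w4' w5' w6',
  model_isomorphic (Dgen a l1 l2 m n c1 c2 w3 w4 w5 w6)
    (Dgen a l1' l2' 0 0 c1 c2 w3' w4' w5' w6').
Proof.
suff [p [q [r [s [nrm mE nE]]]]] : exists p q r s, [/\
    p ^+ 2 + q ^+ 2 + r ^+ 2 + s ^+ 2 = 1,
    (l1 - l2) * (p * s + q * r) + m * (r ^+ 2 - s ^+ 2) - n * r * s *+ 2
        + m * (p ^+ 2 - q ^+ 2) + n * p * q *+ 2 = 0 &
    (l1 - l2) * (p * r - q * s) - n * (r ^+ 2 - s ^+ 2) - m * r * s *+ 2
        + n * (p ^+ 2 - q ^+ 2) - m * p * q *+ 2 = 0].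
  have := Dgen_unitary a l1 l2 m n c1 c2 w3 w4 w5 w6 nrm.
  by rewrite mE nE; do 6!econstructor; eassumption.
have [mn0|mn0] := eqVneq (m ^+ 2 + n ^+ 2) 0.
  move/eqP: mn0; rewrite paddr_eq0 ?sqr_ge0 // !sqrf_eq0 => /andP[/eqP-> /eqP->].
  by exists 1, 0, 0, 0; split; ring.
have mn_gt0 : 0 < m ^+ 2 + n ^+ 2 by rewrite lt_neqAle eq_sym mn0 addr_ge0 ?sqr_ge0.
(* With mu = m + i n, the vector (mu, i k) is an eigenvector for the eigenvalue
   - i (l1 - k) as soon as k solves k^2 = (l1 - l2) k + |mu|^2; d is the square
   root of the discriminant. *)
pose d := Num.sqrt ((l1 - l2) ^+ 2 + 4 * (m ^+ 2 + n ^+ 2)).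
have dE : d ^+ 2 = (l1 - l2) ^+ 2 + 4 * (m ^+ 2 + n ^+ 2).
  by rewrite sqr_sqrtr // addr_ge0 ?sqr_ge0 // mulr_ge0 // ltW.
pose k := (l1 - l2 + d) / 2.
have kE : k ^+ 2 = (l1 - l2) * k + m ^+ 2 + n ^+ 2.
  have -> : k ^+ 2 = ((l1 - l2) ^+ 2 + 2 * (l1 - l2) * d + d ^+ 2) / 4.
    by rewrite /k; field.
  by rewrite dE /k; field.
pose N := Num.sqrt (m ^+ 2 + n ^+ 2 + k ^+ 2).
have N_gt0 : 0 < N by rewrite sqrtr_gt0 ltr_pwDl ?sqr_ge0.
have NE : N ^+ 2 = m ^+ 2 + n ^+ 2 + k ^+ 2.
  by rewrite sqr_sqrtr // addr_ge0 ?sqr_ge0 // ltW.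
have N0 : N != 0 by rewrite gt_eqF.
exists (m / N), (n / N), 0, (k / N).
have zero c : c * ((l1 - l2) * k - k ^+ 2 + m ^+ 2 + n ^+ 2) / N ^+ 2 = 0.
  by rewrite kE; ring.
split.
- have -> : (m / N) ^+ 2 + (n / N) ^+ 2 + 0 ^+ 2 + (k / N) ^+ 2 =
    (m ^+ 2 + n ^+ 2 + k ^+ 2) / N ^+ 2 by field.
  by rewrite -NE divff // expf_neq0.
- by rewrite -[RHS](zero m); field.
- by rewrite -[RHS](zero (- n)); field.
Qed.

(** The shift equation on one complex coordinate of [S], where [A + a] is
    multiplication by [a - i l]: either this is invertible and [u + i v] can be
    killed, or it is zero. *)
Lemma solve_similitude (K : realFieldType) (a l u v : K) : exists x y,
  [/\ a * (u + a * x + l * y) = 0, l * (u + a * x + l * y) = 0,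
      a * (v + a * y - l * x) = 0 & l * (v + a * y - l * x) = 0].
Proof.
have [al0|al0] := eqVneq (a ^+ 2 + l ^+ 2) 0.
  move/eqP: al0; rewrite paddr_eq0 ?sqr_ge0 // !sqrf_eq0 => /andP[/eqP-> /eqP->].
  by exists 0, 0; split; rewrite mul0r.
exists ((- a * u + l * v) / (a ^+ 2 + l ^+ 2)).
exists (- (a * v + l * u) / (a ^+ 2 + l ^+ 2)).
by split; field.
Qed.

Definition has_normal_form (D : 'M[R]_7) : Prop :=
  exists D0, [\/ case_a D0, case_b D0 | case_c D0] /\ model_isomorphic D D0.

Lemma has_normal_form_trans (D D' : 'M[R]_7) :
  model_isomorphic D D' -> has_normal_form D' -> has_normal_form D.
Proof.
move=> DD' [D0 [caseD0 D'D0]]; exists D0; split; first exact: caseD0.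
exact: unitary_Lie_isomorphic_trans DD' D'D0.
Qed.

Lemma has_normal_form_eq (D D' D0 : 'M[R]_7) :
  model_isomorphic D D' -> D' = D0 ->
  [\/ case_a D0, case_b D0 | case_c D0] -> has_normal_form D.
Proof. by move=> DD' <- caseD'; exists D'. Qed.

(** The shift comes after the diagonalisation, because the condition on [w] can
    then be met one complex coordinate of [S] at a time. *)
Lemma Dgen_normal_form (a l1 l2 m n c1 c2 w3 w4 w5 w6 : R) :
  has_normal_form (Dgen a l1 l2 m n c1 c2 w3 w4 w5 w6).
Proof.
have [k1 [k2 [x3 [x4 [x5 [x6 iso]]]]]] :=
  Dgen_diagonalize a l1 l2 m n c1 c2 w3 w4 w5 w6.
apply: has_normal_form_trans iso _.
have [v3 [v4 [a3 k13 a4 k14]]] := solve_similitude a k1 x3 x4.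
have [v5 [v6 [a5 k25 a6 k26]]] := solve_similitude a k2 x5 x6.
apply: has_normal_form_trans
  (Dgen_shift a k1 k2 c1 c2 x3 x4 x5 x6 v3 v4 v5 v6 0) _.
move: (c1 + _ - _ - _ + _) => {}c1.
move: (x3 + _ + _) (x4 + _ - _) (x5 + _ + _) (x6 + _ - _)
  a3 k13 a4 k14 a5 k25 a6 k26.
move=> {x3 x4 x5 x6 w3 w4 w5 w6} w3 w4 w5 w6.
(* From here on (A + a) w = 0, coordinatewise: a and k1 kill w3, w4, while a and
   k2 kill w5, w6. *)
have [-> _ {m n l1 l2} k13 _ k14 _ k25 _ k26|a0] := eqVneq a 0; last first.
  have w0 (w : R) : a * w = 0 -> w = 0.
    by move=> /eqP; rewrite mulf_eq0 (negPf a0) => /eqP.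
  move=> /w0-> _ /w0-> _ /w0-> _ /w0-> _.
  apply: has_normal_form_trans
    (Dgen_shift a k1 k2 c1 c2 0 0 0 0 0 0 0 0 (- c1 / (2 * a))) _.
  apply: has_normal_form_eq (@Dgen_scale _ _ _ _ _ _ _ _ _ _ _ _ (- a) _) _ _.
  - by rewrite oppr_eq0.
  - by rewrite (_ : Dgen _ _ _ _ _ _ _ _ _ _ _ =
      Dgen (-1) (k1 / - a) (k2 / - a) 0 0 0 (c2 / (- a) ^+ 3) 0 0 0 0) //;
      congr Dgen; field.
  - apply: Or31; exists (k1 / - a), (k2 / - a); apply: Or41.
    exists (c2 / (- a) ^+ 3).
    by rewrite Dgen_diag /D1 scale0r addr0 !scaleN1r opprK addrAC.
have [w0|w0] := eqVneq (w3 ^+ 2 + w4 ^+ 2 + w5 ^+ 2 + w6 ^+ 2) 0.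
  have {w0} [-> -> -> ->] : [/\ w3 = 0, w4 = 0, w5 = 0 & w6 = 0].
    move/eqP: w0; rewrite !paddr_eq0 ?addr_ge0 ?sqr_ge0 // !sqrf_eq0.
    by move=> /andP[/andP[/andP[/eqP-> /eqP->] /eqP->] /eqP->].
  have [->|c20] := eqVneq c2 0; last first.
    have [t tE] := cube_root c2.
    have t0 : t != 0 by apply: contra_neq c20 => t0; rewrite -tE t0 expr0n.
    apply: has_normal_form_eq (@Dgen_scale _ _ _ _ _ _ _ _ _ _ _ _ t t0) _ _.
      rewrite (_ : Dgen _ _ _ _ _ _ _ _ _ _ _ =
        Dgen 0 (k1 / t) (k2 / t) 0 0 (c1 / c2) 1 0 0 0 0) //.
      by rewrite tE divff // !mul0r.
    apply: Or31; exists (k1 / t), (k2 / t); apply: Or42; exists (c1 / c2).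
    by rewrite Dgen_diag /D4 !scale0r !addr0 subr0 scale1r.
  have [->|c10] := eqVneq c1 0; last first.
    have [t tE] := cube_root c1.
    have t0 : t != 0 by apply: contra_neq c10 => t0; rewrite -tE t0 expr0n.
    apply: has_normal_form_eq (@Dgen_scale _ _ _ _ _ _ _ _ _ _ _ _ t t0) _ _.
      rewrite (_ : Dgen _ _ _ _ _ _ _ _ _ _ _ =
        Dgen 0 (k1 / t) (k2 / t) 0 0 1 0 0 0 0 0) //.
      by rewrite tE divff // !mul0r.
    apply: Or31; exists (k1 / t), (k2 / t); apply: Or43.
    by rewrite Dgen_diag /D5 !scale0r !addr0 subr0 scale1r.
  apply: has_normal_form_eq (@Dgen_scale _ _ _ _ _ _ _ _ _ _ _ _ 1 _) _ _.
  - exact: oner_neq0.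
  - by rewrite expr1n !divr1 !mul0r.
  - apply: Or31; exists k1, k2; apply: Or44.
    by rewrite Dgen_diag /D6 !scale0r !addr0 subr0.
(* Now A w = 0.  Rotating e3 to w / |w| leaves on the orthogonal line the
   eigenvalue l, equal to the trace k1 + k2. *)
pose N := Num.sqrt (w3 ^+ 2 + w4 ^+ 2 + w5 ^+ 2 + w6 ^+ 2).
have NE : N ^+ 2 = w3 ^+ 2 + w4 ^+ 2 + w5 ^+ 2 + w6 ^+ 2.
  by rewrite sqr_sqrtr // !addr_ge0 ?sqr_ge0.
have N0 : N != 0 by rewrite -sqrf_eq0 NE.
have N_gt0 : 0 < N by rewrite lt_neqAle eq_sym N0 sqrtr_ge0.
have nrm : (w3 / N) ^+ 2 + (w4 / N) ^+ 2 + (w5 / N) ^+ 2 + (w6 / N) ^+ 2 = 1.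
  by rewrite !expr_div_n -!mulrDl -NE divff // sqrf_eq0.
pose l := (k1 * (w5 ^+ 2 + w6 ^+ 2) + k2 * (w3 ^+ 2 + w4 ^+ 2)) / N ^+ 2.
apply: has_normal_form_trans (Dgen_unitary _ _ _ _ _ _ _ _ _ _ _ nrm) _.
rewrite (_ : Dgen _ _ _ _ _ _ _ _ _ _ _ = Dgen 0 0 l 0 0 c1 c2 N 0 0 0); last first.
  congr Dgen; rewrite ?(mul0r, mul0rn, subr0, addr0).
  - rewrite [LHS](_ : _ = (k1 * w3 * w3 + k1 * w4 * w4
      + k2 * w5 * w5 + k2 * w6 * w6) / N ^+ 2); last by field.
    by rewrite k13 k14 k25 k26; ring.
  - by rewrite /l; field.
  - rewrite [LHS](_ : _ = (k1 * w3 * w6 + k1 * w4 * w5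
      - k2 * w5 * w4 - k2 * w6 * w3) / N ^+ 2); last by field.
    by rewrite k13 k14 k25 k26; ring.
  - rewrite [LHS](_ : _ = (k1 * w3 * w5 - k1 * w4 * w6
      - k2 * w5 * w3 + k2 * w6 * w4) / N ^+ 2); last by field.
    by rewrite k13 k14 k25 k26; ring.
  - rewrite [LHS](_ : _ = (w3 ^+ 2 + w4 ^+ 2 + w5 ^+ 2 + w6 ^+ 2) / N).
      by rewrite -NE; field.
    by field.
  1-3: by field.
apply: has_normal_form_trans
  (Dgen_shift _ _ _ _ _ _ _ _ _ 0 (c1 / (2 * N)) 0 0 0) _.
rewrite (_ : Dgen _ _ _ _ _ _ _ _ _ _ _ = Dgen 0 0 l 0 0 0 c2 N 0 0 0); last first.
  by congr Dgen; field.
have [->|c20] := eqVneq c2 0; last first.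
  have [t tE] := cube_root c2.
  have t0 : t != 0 by apply: contra_neq c20 => t0; rewrite -tE t0 expr0n.
  apply: (@has_normal_form_eq _ _ (Dc (N / t ^+ 2) (l / t))
    (@Dgen_scale _ _ _ _ _ _ _ _ _ _ _ _ t t0)).
    by rewrite tE divff // !mul0r Dgen_Dc.
  apply: Or33; exists (N / t ^+ 2), (l / t); split=> //.
  by rewrite divr_ge0 ?sqr_ge0 // ltW.
(* The sign of t is free, as w scales by t ^- 2; it is chosen to make l / t
   nonnegative. *)
pose t := (if 0 <= l then 1 else -1) * Num.sqrt N.
have tE : t ^+ 2 = N.
  by rewrite /t exprMn sqr_sqrtr ?(ltW N_gt0) //; case: ifP => _; ring.
have t0 : t != 0 by rewrite -sqrf_eq0 tE.
apply: (@has_normal_form_eq _ _ (Db (l / t))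
  (@Dgen_scale _ _ _ _ _ _ _ _ _ _ _ _ t t0)).
  by rewrite tE divff // !mul0r Dgen_Db.
apply: Or32; exists (l / t) => //.
rewrite -(pmulr_lge0 _ N_gt0) -tE [leRHS](_ : _ = l * t); last by field.
rewrite /t; have [l0|l0] := leP 0 l; first by rewrite mul1r mulr_ge0 ?sqrtr_ge0.
by rewrite mulN1r mulrN -mulNr mulr_ge0 ?sqrtr_ge0 // oppr_ge0 ltW.
Qed.

End Classification.

Theorem proposition3p12 (R : realType) (V : vectType R)
    (b : lieBracket V) (J : 'End(V)) (g : {symmetric V}) (h : {vspace V})
    (dimV : \dim {:V} = 8%N)
    (pK : pseudo_Kahler b J g)
    (sgn : has_signature g 6 2)
    (ab_h : codim1_abelian_ideal b h)
    (iso_h0 : isotropic g (orthov g h + J @: orthov g h)%VS) :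
  exists D : 'M[R]_7,
    [\/ case_a D, case_b D | case_c D] /\
    unitary_Lie_isomorphic b J g
      (model_bracket D) (model_J R) (model_g R).
Proof.
have [dimh ideal_h] := ab_h.
have [e1 [e10 e1h hE]] := exists_normal_vector pK dimh.
have e1h0 : e1 \in (orthov g h + J @: orthov g h)%VS by apply: (subvP (addvSl _ _)).
have g11 : g e1 e1 = 0 by apply: iso_h0.
have [e7 [g17 g18 g77]] := exists_null_partner pK e10 g11.
have [e3 [e5 uf]] := exists_unitary_frame pK dimV sgn g11 g77 g17 g18.
have [a [l1 [l2 [m [n [c1 [c2 [w3 [w4 [w5 [w6 isoD]]]]]]]]]]] :=
  frame_isomorphic pK dimV uf ideal_h hE.
have [D [caseD isoD']] := Dgen_normal_form a l1 l2 m n c1 c2 w3 w4 w5 w6.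
by exists D; split=> //; apply: unitary_Lie_isomorphic_trans isoD isoD'.
Qed.
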